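(* Let $\mathcal{A}=(A_i)_{i\in I}$ and $\mathcal{B}=(B_j)_{j\in J}$ be collections, with $I\neq\varnothing$ and $J\neq\varnothing$, of nonempty closed subsets of $X$ such that $A:=\bigcup_{i\in I}A_i$ and $B:=\bigcup_{j\in J}B_j$ are closed, and let $c\in A\cap B$. Let $\widetilde{\mathcal{A}}=(\widetilde A_i)_{i\in I}$ and $\widetilde{\mathcal{B}}=(\widetilde B_j)_{j\in J}$ be collections of nonempty subsets of $X$ such that $P_{A_i}((\operatorname{bdry}B)\smallsetminus A)\subseteq\widetilde A_i$ for every $i\in I$ and $P_{B_j}((\operatorname{bdry}A)\smallsetminus B)\subseteq\widetilde B_j$ for every $j\in J$. Set $\widetilde A:=\bigcup_{i\in I}\widetilde A_i$ and $\widetilde B:=\bigcup_{j\in J}\widetilde B_j$. Assume that $\mathcal{A}$ is $\widetilde B$-joint-superregular at $c$. Let $\overline\theta$ be the limiting joint-CQ-number and $\overline\alpha$ the exact joint-CQ-number at $c$ associated with $(\mathcal{A},\widetilde{\mathcal{A}},\mathcal{B},\widetilde{\mathcal{B}})$. Assume further that one of the following holds: (i) $\overline\theta<1$; (ii) $I$ and $J$ are finite, and $\overline\alpha<1$. Let $\theta\in\,]\overline\theta,1[$ and set $\varepsilon:=(\theta-\overline\theta)/3>0$. Then there exists $\delta>0$ such that the following hold: (iii) $\mathcal{A}$ is $(\widetilde B,\varepsilon,3\delta)$-joint-regular at $c$; (iv) $\theta_{3\delta}\leq\overline\theta+\varepsilon<1-2\varepsilon$, where $\theta_{3\delta}$ is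 the joint-CQ-number at $c$ associated with $(\mathcal{A},\widetilde{\mathcal{A}},\mathcal{B},\widetilde{\mathcal{B}})$ and $3\delta$. Consequently, for such $\delta$, if the starting point $b_{-1}\in X$ satisfies $\|b_{-1}-c\|\leq(1-\theta)\delta/12$, then any sequences $(a_n)_{n\in\mathbb N}$ and $(b_n)_{n\in\mathbb N}$ generated by the method of alternating projections with respect to $(A,B)$ with starting point $b_{-1}$ converge linearly with rate $\theta$ to some point $\bar c\in A\cap B$ with $\|\bar c-c\|\leq\delta$: $$(\forall n\geq1)\quad\max\{\|a_n-\bar c\|,\|b_n-\bar c\|\}\leq\frac{\delta(1+\theta)}{2}\theta^{n-1}.$$
   Context: $X$ is a Euclidean space (finite-dimensional real Hilbert space) with inner product $\langle\cdot,\cdot\rangle$ and norm $\|\cdot\|$. $\mathbb N=\{0,1,2,\dots\}$; $\operatorname{bdry}S$ is the boundary of $S$ in $X$. For $S\subseteq X$ nonempty, $\operatorname{cone}(S)=\{\rho s:\rho\geq0,\,s\in S\}$, and $\operatorname{cone}(\varnothing)=\{0\}$. For nonempty $C\subseteq X$, $d_C(x)=\inf_{y\in C}\|x-y\|$, $P_C(x)=\{y\in C:\|x-y\|=d_C(x)\}$ (set-valued projection), $P_C(S)=\bigcup_{x\in S}P_C(x)$, $P_C^{-1}(y)=\{x\in X: y\in P_C(x)\}$. Convention: $\sup\varnothing=-\infty$. Restricted normal cones: for nonempty $C,D\subseteq X$ and $x\in C$, the $D$-restricted proximal normal cone is $\widehat N_C^{D}(x)=\operatorname{cone}((D\cap P_C^{-1}(x))-x)$;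 the $D$-restricted normal cone $N_C^{D}(x)$ is the set of all $u$ for which there exist $x_n\in C$, $u_n\in\widehat N_C^D(x_n)$ with $x_n\to x$ and $u_n\to u$. If $x\notin C$, both are empty. CQ-numbers at $c$: for nonempty sets $C,\widetilde C,D,\widetilde D$ and $\delta>0$, $\theta_\delta(C,\widetilde C,D,\widetilde D)=\sup\{\langle u,v\rangle: u\in\widehat N_C^{\widetilde D}(x),\ v\in-\widehat N_D^{\widetilde C}(y),\ \|u\|\leq1,\ \|v\|\leq1,\ \|x-c\|\leq\delta,\ \|y-c\|\leq\delta\}$ and $\overline\alpha(C,\widetilde C,D,\widetilde D)=\sup\{\langle u,v\rangle: u\in N_C^{\widetilde D}(c),\ v\in-N_D^{\widetilde C}(c),\ \|u\|\leq1,\ \|v\|\leq1\}$. The joint-CQ-number at $c$ associated with $(\mathcal A,\widetilde{\mathcal A},\mathcal B,\widetilde{\mathcal B})$ and $\delta$ is $\theta_\delta=\sup_{(i,j)\in I\times J}\theta_\delta(A_i,\widetilde A_i,B_j,\widetilde B_j)$; the limiting joint-CQ-number is $\overline\theta=\lim_{\delta\downarrow0}\theta_\delta$; the exact joint-CQ-number is $\overline\alpha=\sup_{(i,j)\in I\times J}\overline\alpha(A_i,\widetilde A_i,B_j,\widetilde B_j)$. Regularity: for nonempty $D,E\subseteq X$, $\varepsilon\geq0$, $\delta>0$, the set $D$ is $(E,\varepsilon,\delta)$-regular at $c$ if $\langle u,y-b\rangle\leq\varepsilon\|u\|\,\|y-b\|$ whenever $y,b\in D$, $\|y-c\|\leq\delta$,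 $\|b-c\|\leq\delta$, $u\in\widehat N_D^{E}(b)$. The set $D$ is $E$-superregular at $c$ if for every $\varepsilon>0$ there exists $\delta>0$ such that $D$ is $(E,\varepsilon,\delta)$-regular at $c$. A collection is $(E,\varepsilon,\delta)$-joint-regular at $c$ if each of its members is $(E,\varepsilon,\delta)$-regular at $c$. A collection is $E$-joint-superregular at $c$ if each of its members is $E$-superregular at $c$. Method of alternating projections (MAP) for $(A,B)$ with starting point $b_{-1}\in X$: any sequences with $a_n\in P_A(b_{n-1})$ and $b_n\in P_B(a_n)$ for all $n\in\mathbb N$. A sequence $(x_n)$ converges linearly to $\bar x$ with rate $\gamma\in[0,1[$ if there is $\mu\geq0$ with $\|x_n-\bar x\|\leq\mu\gamma^n$ for all $n\in\mathbb N$.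
   Formalization: For infinite I the collection is assumed uniformly joint-superregular (for each ε one δ serves all members A_i); with memberwise superregularity alone (iii) can fail, e.g. X=ℝ, c=0, A_r={r,2r}, Ã_r={0}, B={0}, B̃=ℝ. Finite I is unchanged. *)

(* Defs.v *)
From HB Require Import structures.
From mathcomp Require Import all_boot all_order all_algebra sesquilinear.
From mathcomp Require Import all_classical all_reals all_analysis.

Set Implicit Arguments.
Unset Strict Implicit.
Unset Printing Implicit Defensive.

Import Order.TTheory GRing.Theory Num.Theory.
Import numFieldNormedType.Exports.

Local Open Scope classical_set_scope.
Local Open Scope ring_scope.

(* A Euclidean space is a normed module X over R with a dot product [dot]
   inducing its norm, and spanned by finitely many vectors.  The topological
   notions (closed, closure, interior, convergence) are those of this norm. *)
Definition euclidean (R : realType) (X : normedModType R)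
    (dot : {dot X for @idfun R}) : Prop :=
  (forall x : X, `|x| ^+ 2 = dot x x) /\
  (exists (n : nat) (e : 'I_n -> X), forall x : X,
     exists a : 'I_n -> R, x = \sum_(i < n) a i *: e i).

Section Sets.
Context {R : realType} {X : normedModType R}.
Implicit Types (C D E S : set X) (c x y u v : X).

Definition bdry S : set X := closure S `\` interior S.

(* The left disjunct encodes the convention cone(set0) = {0}. *)
Definition cone S : set X :=
  [set u | (S = set0 /\ u = 0) \/
           exists rho s, [/\ 0 <= rho, S s & u = rho *: s]].

(* [inf] is the real infimum; it is only used below for a nonempty C, as
   [proj C x] is empty when C is. *)
Definition dist_to C x : R := inf [set `|x - y| | y in C].

Definition proj C x : set X := [set y | C y /\ `|x - y| = dist_to C x].

Definition proj_set C S : set X := \bigcup_(x in S) proj C x.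

Definition proj_inv C y : set X := [set x | proj C x y].

Definition prox_normal C D x : set X :=
  [set u | C x /\ cone [set z - x | z in D `&` proj_inv C x] u].

Definition normal_cone C D x : set X :=
  [set u | C x /\
     exists (x_ u_ : nat -> X),
       [/\ forall n, C (x_ n),
           forall n, prox_normal C D (x_ n) (u_ n),
           x_ n @[n --> \oo] --> x &
           u_ n @[n --> \oo] --> u]].

Definition MAP A B (b0 : X) (a b : nat -> X) : Prop :=
  [/\ proj A b0 (a 0%N),
      forall n, proj A (b n) (a n.+1) &
      forall n, proj B (a n) (b n)].

Definition converges_linearly (x_ : nat -> X) (xbar : X) (gamma : R) : Prop :=
  0 <= gamma < 1 /\
  exists2 mu : R, 0 <= mu & forall n, `|x_ n - xbar| <= mu * gamma ^+ n.

End Sets.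

Section InnerProduct.
Context {R : realType} {X : normedModType R} (dot : {dot X for @idfun R}).
Implicit Types (C Ct D Dt E : set X) (c : X) (eps delta : R).

(* The suprema are taken in \bar R, where ereal_sup set0 = -oo. *)
Definition CQ_number c delta C Ct D Dt : \bar R :=
  ereal_sup [set r | exists x y u v : X,
    [/\ prox_normal C Dt x u, prox_normal D Ct y (- v),
        `|u| <= 1 /\ `|v| <= 1, `|x - c| <= delta /\ `|y - c| <= delta &
        r = (dot u v)%:E]].

Definition exact_CQ_number c C Ct D Dt : \bar R :=
  ereal_sup [set r | exists u v : X,
    [/\ normal_cone C Dt c u, normal_cone D Ct c (- v),
        `|u| <= 1, `|v| <= 1 & r = (dot u v)%:E]].

Definition joint_CQ_number (I J : Type) (A At : I -> set X) (B Bt : J -> set X)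
    c delta : \bar R :=
  ereal_sup (range (fun p : I * J =>
    CQ_number c delta (A p.1) (At p.1) (B p.2) (Bt p.2))).

Definition limiting_joint_CQ_number (I J : Type) (A At : I -> set X)
    (B Bt : J -> set X) c : \bar R :=
  lim (joint_CQ_number A At B Bt c delta @[delta --> 0^'+]).

Definition exact_joint_CQ_number (I J : Type) (A At : I -> set X)
    (B Bt : J -> set X) c : \bar R :=
  ereal_sup (range (fun p : I * J =>
    exact_CQ_number c (A p.1) (At p.1) (B p.2) (Bt p.2))).

Definition regular E eps delta c D : Prop :=
  forall y b u : X, D y -> D b -> `|y - c| <= delta -> `|b - c| <= delta ->
    prox_normal D E b u -> dot u (y - b) <= eps * `|u| * `|y - b|.

Definition superregular E c D : Prop :=
  forall eps, 0 < eps -> exists2 delta, 0 < delta & regular E eps delta c D.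

Definition joint_regular (I : Type) E eps delta c (A : I -> set X) : Prop :=
  forall i, regular E eps delta c (A i).

Definition joint_superregular (I : Type) E c (A : I -> set X) : Prop :=
  forall i, superregular E c (A i).

(* Here delta does not depend on the member of the collection; for a finite
   collection this is equivalent to [joint_superregular]. *)
Definition uniformly_joint_superregular (I : Type) E c (A : I -> set X) : Prop :=
  forall eps, 0 < eps ->
    exists2 delta, 0 < delta & joint_regular E eps delta c A.

End InnerProduct.

(* Main.v *)
Require Import Defs.
From HB Require Import structures.
From mathcomp Require Import all_boot all_order all_algebra sesquilinear.
From mathcomp Require Import all_classical all_reals all_analysis.
From mathcomp Require Import ring lra.

(** The heart of the matter is a one-step contraction.  Let [a0], [b0], [a1],
    [b1], [a2] be consecutive iterates near [c], with [a1] in the member [A_ i]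
    and [b1] in [B_ j], and let [a'] be a projection of [b1] onto that same
    [A_ i].  Then [b1 - a'] is a restricted normal to [A_ i] at [a'], and
    [a1 - b1] is a restricted normal to [B_ j] at [b1], so that with [k] a bound
    of the joint-CQ-number,
      <b1 - a', b1 - a1> <= k |b1 - a'| |a1 - b1|,
    while regularity of [A_ i], applied to its two points [a1] and [a'], gives
      <b1 - a', a1 - a'> <= eps |b1 - a'| |a1 - a'|
                        <= 2 eps |b1 - a'| |a1 - b1|.
    The left-hand sides add up to |b1 - a'|^2, whence ([CQ_contraction])
      |b1 - a'| <= (k + 2 eps) |a1 - b1|.
    The iterate [a2] may lie in another member of the collection, where
    regularity says nothing about [a1]; but it is nearest to [b1] in the whole
    union, so |b1 - a2| <= |b1 - a'| ([MAP_step]).  With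
    k = thetabar + eps the factor is exactly theta.

    The gaps |b_n - a_(n+1)| therefore decay like theta^n.  An induction shows
    that the iterates never leave the ball in which the contraction is valid,
    because the total length of the path is a small fraction of delta
    ([MAP_linear_convergence]); being Cauchy, both sequences converge, to one
    and the same point, which lies in the closed sets A and B.

    A suitable delta exists because the joint-CQ-number is nondecreasing in
    delta, so that its limit at 0 from the right is an infimum over the positive
    radii ([limiting_joint_CQ_numberE]).  Finally, condition (ii) implies (i)
    by compactness ([CQ_number_lt]): if [<u_n, v_n>] tends to 1 in the unit
    ball, then |u_n - v_n|^2 <= 2 - 2 <u_n, v_n> tends to 0, so along a
    subsequence both converge to the same unit vector, which shows that the
    exact number is at least 1.

    Compactness of closed balls, which also provides projections onto closed
    sets, follows from the existence of an orthonormal basis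
    ([compact_closed_ball]). *)

Set Implicit Arguments.
Unset Strict Implicit.
Unset Printing Implicit Defensive.

Import Order.TTheory GRing.Theory Num.Theory.
Import numFieldNormedType.Exports.

Local Open Scope classical_set_scope.
Local Open Scope ring_scope.

(* The product topology has a homonymous family of projections. *)
Local Notation proj := Defs.proj.

(** * Inner product and compactness of closed balls *)

Section Euclidean.
Context {R : realType} {X : normedModType R} (dot : {dot X for @idfun R}).
Hypothesis hX : euclidean dot.
Implicit Types (x y z u v f : X) (a r : R) (s t : seq X).

Lemma dotC x y : dot x y = dot y x.
Proof. by have := hermitian_subproof (s := dot) x y; rewrite expr0 mul1r. Qed.

Lemma dotBl x y z : dot (x - y) z = dot x z - dot y z.
Proof. exact: (zmod_morphisml_subproof z). Qed.

Lemma dotZl a x y : dot (a *: x) y = a * dot x y.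
Proof. exact: (linearl_subproof y). Qed.

Lemma dotBr x y z : dot x (y - z) = dot x y - dot x z.
Proof. by rewrite dotC dotBl !(dotC x). Qed.

Lemma dotZr a x y : dot x (a *: y) = a * dot x y.
Proof. by rewrite dotC dotZl dotC. Qed.

Lemma dot0l x : dot 0 x = 0.
Proof. by rewrite -(subrr x) dotBl subrr. Qed.

Lemma dotNl x y : dot (- x) y = - dot x y.
Proof. by rewrite -(sub0r x) dotBl dot0l sub0r. Qed.

Lemma dotDl x y z : dot (x + y) z = dot x z + dot y z.
Proof. by rewrite -{1}(opprK y) dotBl dotNl opprK. Qed.

Lemma dotDr x y z : dot x (y + z) = dot x y + dot x z.
Proof. by rewrite dotC dotDl !(dotC x). Qed.

Lemma dotxx x : dot x x = `|x| ^+ 2.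
Proof. by rewrite hX.1. Qed.

Lemma normB_sqr x y : `|x - y| ^+ 2 = `|x| ^+ 2 + `|y| ^+ 2 - 2 * dot x y.
Proof. by rewrite -!dotxx dotBl !dotBr (dotC y x); ring. Qed.

(** For an orthonormal [t], the orthogonal projection onto its span. *)
Definition proj_sum t x : X := \sum_(f <- t) dot x f *: f.

Lemma proj_sum_cons g t x : proj_sum (g :: t) x = dot x g *: g + proj_sum t x.
Proof. by rewrite /proj_sum big_cons. Qed.

Lemma dot_proj_sum t x y : dot (proj_sum t x) y = dot x (proj_sum t y).
Proof.
elim: t => [|g t IH]; first by rewrite /proj_sum !big_nil dot0l dotC dot0l.
by rewrite !proj_sum_cons dotDl dotDr IH dotZl dotZr (dotC y) mulrC.
Qed.

Lemma proj_sumD t x y : proj_sum t (x + y) = proj_sum t x + proj_sum t y.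
Proof.
by rewrite /proj_sum -big_split; apply: eq_bigr => f _; rewrite dotDl scalerDl.
Qed.

Lemma proj_sumZ t a x : proj_sum t (a *: x) = a *: proj_sum t x.
Proof.
by rewrite /proj_sum scaler_sumr; apply: eq_bigr => f _; rewrite dotZl scalerA.
Qed.

(** Orthonormality of [t] is encoded by [proj_sum t] fixing its unit vectors:
    this is all that is needed to extend [t] by one vector, and the vectors
    fixed by [proj_sum t] form a subspace. *)
Lemma gram_schmidt s : exists t : seq X,
  {in t, forall f, `|f| = 1 /\ proj_sum t f = f} /\
  {in s, forall x, proj_sum t x = x}.
Proof.
elim: s => [|e s [t [tP sP]]]; first by exists [::].
(* The part of [e] orthogonal to the span of [t]. *)
pose r := e - proj_sum t e.
have rt f : f \in t -> dot r f = 0.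
  by move=> ft; rewrite dotBl dot_proj_sum (tP _ ft).2 subrr.
have [r0|rN0] := eqVneq r 0.
  exists t; split=> // x; rewrite inE => /predU1P[->|/sP//].
  by apply/esym/eqP; rewrite -subr_eq0 -/r r0.
have nr0 : `|r| != 0 by rewrite normr_eq0.
pose g := `|r|^-1 *: r.
have Pr0 : proj_sum t r = 0.
  by rewrite /proj_sum big_seq big1 // => f ft; rewrite rt ?scale0r.
have gf x : proj_sum t x = x -> dot x g = 0.
  by move=> <-; rewrite dotC -dot_proj_sum proj_sumZ Pr0 scaler0 dot0l.
have nrg : `|g| = 1 by rewrite normrZ normfV normr_id mulVf.
have fixed x : proj_sum t x = x -> proj_sum (g :: t) x = x.
  by move=> xP; rewrite proj_sum_cons (gf _ xP) scale0r add0r.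
have gfix : proj_sum (g :: t) g = g.
  by rewrite proj_sum_cons dotxx nrg expr1n scale1r proj_sumZ Pr0 scaler0 addr0.
exists (g :: t); split.
  move=> f; rewrite inE => /predU1P[->//|ft].
  by have [f1 fP] := tP _ ft; split=> //; exact: fixed.
move=> x; rewrite inE => /predU1P[->|/sP]; last exact: fixed.
have -> : e = `|r| *: g + proj_sum t e.
  by rewrite scalerA divff // scale1r subrK.
rewrite proj_sumD proj_sumZ gfix; congr (_ + _); apply: fixed.
rewrite {1}/proj_sum [RHS]/proj_sum; apply: eq_big_seq => f ft.
by rewrite dot_proj_sum (tP _ ft).2.
Qed.

Lemma orthonormal_expansion : exists t : seq X,
  {in t, forall f, `|f| = 1} /\ forall x, proj_sum t x = x.
Proof.
have [n [e espan]] := hX.2.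
have [t [tP eP]] := gram_schmidt [seq e i | i <- enum 'I_n].
exists t; split=> [f /tP[]//|x]; have [a ->] := espan x.
elim/big_ind: _ => [|y z yP zP|i _].
- by rewrite -{1}(scale0r 0) proj_sumZ scale0r.
- by rewrite proj_sumD yP zP.
- by rewrite proj_sumZ eP // map_f ?mem_enum.
Qed.

(** Bessel's inequality for one vector: expand |x - <x,f> f|^2 >= 0. *)
Lemma normr_dot_unit x f : `|f| = 1 -> `|dot x f| <= `|x|.
Proof.
move=> f1; rewrite -(@ler_pXn2r _ 2) ?nnegrE // real_normK ?num_real//.
have := sqr_ge0 `|x - dot x f *: f|.
rewrite normB_sqr normrZ f1 mulr1 real_normK ?num_real// dotZr; nra.
Qed.

(** The linear combinations of [t] with coefficients in [- r, r], built by
    recursion so that compactness follows from that of a product of two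
    compact sets. *)
Fixpoint coef_box r t : set X :=
  if t is f :: t' then
    (fun p : R * X => p.1 *: f + p.2) @` (`[- r, r] `*` coef_box r t')
  else [set 0].

Lemma compact_coef_box r t : compact (coef_box r t).
Proof.
elim: t => [|f t IH] /=; first exact: compact_set1.
apply: continuous_compact; last first.
  by apply: compact_setX => //; exact: segment_compact.
apply: continuous_subspaceT => p.
apply: cvgD; last exact: cvg_snd.
apply: cvgZr_tmp; exact: cvg_fst.
Qed.

(** The coordinates of a point in an orthonormal basis are bounded by its norm,
    so a ball is a closed part of a compact box of coefficients. *)
Lemma compact_closed_ball x r : compact [set y | `|x - y| <= r].
Proof.
have [t [t1 tP]] := orthonormal_expansion.
apply: (@subclosed_compact _ _ (coef_box (r + `|x|) t)).
- exact: closed_closed_ball_.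
- exact: compact_coef_box.
move=> y /= xyr; rewrite -(tP y).
have {xyr} yr : `|y| <= r + `|x|.
  by have := lerB_dist y x; rewrite (distrC y); lra.
elim: t t1 {tP} => [|f t IH] t1 /=; first by rewrite /proj_sum big_nil.
rewrite proj_sum_cons; exists (dot y f, proj_sum t y) => //=; split.
  rewrite /= in_itv /= -ler_norml (le_trans _ yr) // normr_dot_unit //.
  by apply: t1; rewrite inE eqxx.
by apply: IH => g gt; apply: t1; rewrite inE gt orbT.
Qed.

End Euclidean.

(** * Projections and proximal normals *)

Section Projection.
Context {R : realType} {X : normedModType R}.
Implicit Types (C D S : set X) (x y z u v : X).

Lemma closed_approx S x : closed S ->
  (forall e : R, 0 < e -> exists2 s, S s & `|s - x| < e) -> S x.
Proof.
move=> Scl xS; apply: Scl => N /nbhs_ballP[e /= e0 eN].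
have [s Ss sx] := xS _ e0; exists s; split=> //; apply: eN.
by rewrite -ball_normE /= distrC.
Qed.

Lemma projP C x y :
  proj C x y <-> C y /\ forall z, C z -> `|x - y| <= `|x - z|.
Proof.
have lb : has_lbound [set `|x - y| | y in C] by exists 0 => _ [z _ <-].
split=> [[Cy yx]|[Cy yx]].
  by split=> // z Cz; rewrite yx; apply: ge_inf => //; exists z.
split=> //; apply/eqP; rewrite eq_le; apply/andP; split.
  apply: lb_le_inf; first by exists `|x - y|, y.
  by move=> _ [z Cz <-]; exact: yx.
by apply: ge_inf => //; exists y.
Qed.

Lemma proj_sub C D x y : D `<=` C -> D y -> proj C x y -> proj D x y.
Proof. by move=> DC Dy /projP[_ yx]; apply/projP; split=> // z /DC/yx. Qed.

Lemma proj_id C x y : C x -> proj C x y -> y = x.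
Proof.
move=> Cx /projP[_ /(_ _ Cx)]; rewrite subrr normr0 normr_le0 subr_eq0.
by move=> /eqP.
Qed.

(** If [y] were interior to [C], moving it slightly towards [x] would stay in
    [C] and come closer to [x]. *)
Lemma proj_bdry C x y : ~ C x -> proj C x y -> bdry C y.
Proof.
move=> nCx /projP[Cy yx]; split; first exact: subset_closure.
rewrite /interior => /nbhs_ballP[e /= e0 eC].
have xy0 : 0 < `|x - y|.
  by rewrite normr_gt0 subr_eq0; apply/eqP => xy; apply: nCx; rewrite xy.
set d := `|x - y| in xy0 yx.
(* A number in ]0, 1[ with [t * d < e]. *)
pose t := e / (e + d).
have t0 : 0 < t by rewrite divr_gt0 // addr_gt0.
have td : t * d < e by rewrite /t mulrAC ltr_pdivrMr ?addr_gt0 //; nra.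
have t1 : t < 1 by rewrite /t ltr_pdivrMr ?addr_gt0 // mul1r ltrDl.
have : C (y + t *: (x - y)).
  by apply: eC; rewrite -ball_normE /= opprD addNKr normrN normrZ gtr0_norm.
move/yx; have -> : x - (y + t *: (x - y)) = (1 - t) *: (x - y).
  by rewrite scalerBl scale1r opprD addrA.
rewrite normrZ ger0_norm ?subr_ge0 ?(ltW t1) // -/d => dle.
by have := mulr_gt0 t0 xy0; lra.
Qed.

Lemma prox_normal_proj C D x z :
  D z -> proj C z x -> prox_normal C D x (z - x).
Proof.
move=> Dz Czx; split; first exact: Czx.1.
right; exists 1, (z - x); split=> //; last by rewrite scale1r.
by exists z.
Qed.

Lemma prox_normalZ C D x u (k : R) :
  0 <= k -> prox_normal C D x u -> prox_normal C D x (k *: u).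
Proof.
move=> k0 [Cx [[S0 ->]|[rho [s [rho0 Ss ->]]]]]; split=> //.
  by left; rewrite scaler0.
by right; exists (k * rho), s; rewrite mulr_ge0 // scalerA.
Qed.

(** The convention [cone set0 = [set 0]] is what makes this hold even if no
    point of [D] projects onto [x]. *)
Lemma prox_normal0 C D x : C x -> prox_normal C D x 0.
Proof.
move=> Cx; split=> //; set S := [set _ | _ in _].
have [S0|/set0P[s Ss]] := eqVneq S set0; [by left|right].
by exists 0, s; rewrite scale0r.
Qed.

End Projection.

Section EuclideanProjection.
Context {R : realType} {X : normedModType R} (dot : {dot X for @idfun R}).
Hypothesis hX : euclidean dot.

(** Minimise the distance over the compact part of [C] that is at least as
    close to [x] as some given point of [C]. *)
Lemma proj_exists (C : set X) x : closed C -> C !=set0 -> proj C x !=set0.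
Proof.
move=> Ccl [z Cz].
pose K := C `&` [set y | `|x - y| <= `|x - z|].
have Kc : compact K.
  apply: (@subclosed_compact _ _ [set y | `|x - y| <= `|x - z|]).
  - by apply: closedI => //; exact: closed_closed_ball_.
  - exact: (compact_closed_ball hX).
  - by move=> y [].
have [| |y /set_mem[Cy yz] ymin] :=
  compact_EVT_min (f := fun y => `|x - y|) _ Kc.
- by exists z; split=> /=.
- apply: continuous_subspaceT => y; apply: cvg_norm.
  by apply: cvgB; [exact: cvg_cst|exact: cvg_id].
exists y; apply/projP; split=> // w Cw.
have [wz|/ltW zw] := leP `|x - w| `|x - z|; first by apply: ymin; rewrite inE.
exact: le_trans yz zw.
Qed.

Lemma bounded_cluster (u : nat -> X) x r : (forall n, `|u n - x| <= r) ->
  exists2 l, `|l - x| <= r &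
    forall e n, 0 < e -> exists2 m, (n <= m)%N & `|u m - l| < e.
Proof.
move=> ur.
have uF : ProperFilter (u @ \oo) by exact: fmap_proper_filter.
have uK : (u @ \oo) [set y | `|x - y| <= r].
  by exists 0%N => // n _; rewrite /= distrC.
have [l [lr lu]] := compact_closed_ball hX uF uK.
exists l; first by rewrite distrC.
move=> e n e0.
have [||_ [[m nm <-]]] := lu [set u m | m in [set m | (n <= m)%N]] (ball l e).
- by exists n => // m nm; exists m.
- exact: nbhsx_ballx.
- by rewrite -ball_normE /= distrC; exists m.
Qed.

End EuclideanProjection.

(** * CQ-numbers of a pair of sets *)

Section CQ.
Context {R : realType} {X : normedModType R} (dot : {dot X for @idfun R}).
Hypothesis hX : euclidean dot.
Implicit Types (C Ct D Dt E : set X) (c : X) (delta k : R).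

(** Restricted normals form cones, so the bound on the unit ball that defines
    the CQ-number extends to all normals by homogeneity. *)
Lemma CQ_number_dot c delta C Ct D Dt k x y u v :
  (CQ_number dot c delta C Ct D Dt <= k%:E)%E ->
  prox_normal C Dt x u -> prox_normal D Ct y (- v) ->
  `|x - c| <= delta -> `|y - c| <= delta ->
  dot u v <= k * (`|u| * `|v|).
Proof.
move=> /ereal_supP kP Cu Dv xc yc.
have [->|u0] := eqVneq u 0; first by rewrite dot0l normr0 mul0r mulr0.
have [->|v0] := eqVneq v 0; first by rewrite dotC dot0l normr0 !mulr0.
have nu0 : 0 < `|u| by rewrite normr_gt0.
have nv0 : 0 < `|v| by rewrite normr_gt0.
have : dot (`|u|^-1 *: u) (`|v|^-1 *: v) <= k.
  rewrite -lee_fin; apply: kP; exists x, y, (`|u|^-1 *: u), (`|v|^-1 *: v).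
  split=> //; first by apply: prox_normalZ; rewrite ?invr_ge0.
    by rewrite -scalerN; apply: prox_normalZ; rewrite ?invr_ge0.
  by rewrite !normrZ !normfV !normr_id !mulVf ?gt_eqF.
by rewrite dotZl dotZr mulrA -invfM mulrC ler_pdivrMr // mulr_gt0.
Qed.

Lemma CQ_number_nondecreasing c delta delta' C Ct D Dt : delta <= delta' ->
  (CQ_number dot c delta C Ct D Dt <= CQ_number dot c delta' C Ct D Dt)%E.
Proof.
move=> dd'; apply: ereal_sup_le => _ [x [y [u [v [Cu Dv uv [xc yc] ->]]]]].
by exists x, y, u, v; split=> //; split; exact: le_trans dd'.
Qed.

(** The bound [1 - delta] rather than merely [1] survives the supremum over a
    finite family of pairs without having to attain it.  If the bound fails for
    arbitrarily small [delta], there are normals [u_ n] and [v_ n] in the unit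
    ball, at points tending to [c], whose inner product tends to 1; they
    cluster at one common unit vector [l], and [dot l l = 1] is then one of the
    values of which the exact CQ-number is the supremum. *)
Lemma CQ_number_lt c C Ct D Dt : closed C -> closed D ->
  (exact_CQ_number dot c C Ct D Dt < 1)%E ->
  \forall delta \near 0^'+,
    (CQ_number dot c delta C Ct D Dt <= (1 - delta)%R%:E)%E.
Proof.
move=> Ccl Dcl; apply: contraPP => ncq; apply/negP; rewrite -leNgt.
(* Near-extremal data, as ((x, y), (u, v)). *)
have {ncq} cq delta : 0 < delta -> exists p : (X * X) * (X * X),
    [/\ prox_normal C Dt p.1.1 p.2.1, prox_normal D Ct p.1.2 (- p.2.2),
        `|p.2.1| <= 1 /\ `|p.2.2| <= 1,
        `|p.1.1 - c| < delta /\ `|p.1.2 - c| < delta &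
        1 - delta < dot p.2.1 p.2.2].
  move=> d0; apply: contrapT => nex; apply: ncq.
  near=> d; apply/ereal_supP => _ [x [y [u [v [Cu Dv uv [xc yc] ->]]]]].
  rewrite lee_fin leNgt; apply/negP => duv; apply: nex.
  exists ((x, y), (u, v)); split=> //=.
    by split; [apply: le_lt_trans xc _|apply: le_lt_trans yc _]; near: d;
      exact: nbhs_right_lt.
  apply: le_lt_trans duv; rewrite lerD2l lerN2.
  by near: d; exact: nbhs_right_le.
have hpos n : 0 < n.+1%:R^-1 :> R by rewrite invr_gt0 ltr0n.
have /choice[p pP] (n : nat) := cq _ (hpos n).
have [|l l1 lP] :=
  bounded_cluster (u := fun n => (p n).2.1) (x := 0) (r := 1) hX _.
  by move=> n; have [_ _ []] := pP n; rewrite subr0.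
rewrite subr0 in l1.
have /choice[s sP] (n : nat) :
    exists m, (n <= m)%N /\ `|(p m).2.1 - l| < n.+1%:R^-1.
  by have [m] := lP _ n (hpos n); exists m.
pose h n : R := n.+1%:R^-1.
(* The subsequence along which [u_ n] tends to [l].  The last two estimates
   come from 2 <u,v> = |u|^2 + |v|^2 - |u - v|^2 with |u|, |v| <= 1. *)
have {s sP pP lP p} [q qP] : exists q : nat -> (X * X) * (X * X), forall n,
    [/\ prox_normal C Dt (q n).1.1 (q n).2.1,
        prox_normal D Ct (q n).1.2 (- (q n).2.2),
        `|(q n).1.1 - c| < h n /\ `|(q n).1.2 - c| < h n,
        `|(q n).2.1 - l| < h n /\ `|(q n).2.1 - (q n).2.2| ^+ 2 < 2 * h n &
        1 - 3 * h n < `|l| ].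
  exists (p \o s) => n; have [sn us] := sP n.
  have [Cu Dv [u1 v1] [xc yc] uv] := pP (s n).
  have hs : (s n).+1%:R^-1 <= h n by rewrite lef_pV2 ?posrE ?ltr0n// ler_nat.
  have u2 : `|(p (s n)).2.1| ^+ 2 <= `|(p (s n)).2.1|.
    by rewrite expr2 ler_piMr.
  have v2 : `|(p (s n)).2.2| ^+ 2 <= 1 by rewrite expr_le1.
  have uvE := normB_sqr hX (p (s n)).2.1 (p (s n)).2.2.
  have uv0 := sqr_ge0 `|(p (s n)).2.1 - (p (s n)).2.2|.
  have ul := lerB_dist (p (s n)).2.1 l.
  rewrite -/(h n) in us.
  move: (_^-1) hs xc yc uv => t hs xc yc uv.
  split=> //=; try (split=> //); lra.
pose x_ n := (q n).1.1; pose y_ n := (q n).1.2.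
pose u_ n := (q n).2.1; pose v_ n := (q n).2.2.
have cvg_h (w_ : nat -> X) w : (forall n, `|w_ n - w| < h n) ->
    w_ n @[n --> \oo] --> w.
  move=> wh; apply/cvgrPdist_lt => e e0; near=> n.
  rewrite distrC (lt_trans (wh n)) //; near: n.
  exact: (near_infty_natSinv_lt (PosNum e0)).
have xc : x_ n @[n --> \oo] --> c by apply: cvg_h => n; have [_ _ []] := qP n.
have yc : y_ n @[n --> \oo] --> c by apply: cvg_h => n; have [_ _ []] := qP n.
have ul : u_ n @[n --> \oo] --> l by apply: cvg_h => n; have [_ _ _ []] := qP n.
have vl : v_ n @[n --> \oo] --> l.
  apply/cvgrPdist_lt => e e0; near=> n.
  have [_ _ _ [uln uvn] _] := qP n.
  have hn : h n < e / 2.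
    by near: n; apply: (near_infty_natSinv_lt (PosNum (_ : 0 < e / 2))); lra.
  have hn2 : h n < e ^+ 2 / 8.
    near: n; apply: (near_infty_natSinv_lt (PosNum (_ : 0 < e ^+ 2 / 8))).
    by rewrite divr_gt0 // exprn_gt0.
  have {}uvn : `|u_ n - v_ n| < e / 2.
    rewrite -(@ltr_pXn2r _ 2) ?nnegrE ?divr_ge0 ?(ltW e0) //.
    by rewrite exprMn exprVn; lra.
  apply: (le_lt_trans (ler_distD (u_ n) _ _)); rewrite [e]splitr ltrD //.
  by rewrite distrC (lt_trans uln).
have l1' : 1 <= `|l|.
  apply/ler_addgt0Pr => e e0.
  have e3 : 0 < e / 3 by rewrite divr_gt0.
  have [N _ /(_ _ (leqnn N)) /= hN] := near_infty_natSinv_lt (PosNum e3).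
  have [_ _ _ _] := qP N; rewrite /h => lN.
  by move: (_^-1) hN lN => t te tl; lra.
have Cc : C c.
  by apply: (closed_cvg _ Ccl _ _ xc); apply: nearW => n; have [[]] := qP n.
have Dc : D c.
  by apply: (closed_cvg _ Dcl _ _ yc); apply: nearW => n; have [_ []] := qP n.
apply: (@le_trans _ _ (dot l l)%:E).
  by rewrite (dotxx hX) lee_fin exprn_ege1.
apply: ereal_sup_ubound; exists l, l; split=> //.
- by split=> //; exists x_, u_; split=> // n; have [[]] := qP n.
- split=> //; exists y_, (fun n => - v_ n); split=> //.
  + by move=> n; have [_ []] := qP n.
  + by move=> n; have [_ ] := qP n.
  + exact: cvgN.
Unshelve. all: by end_near. Qed.

End CQ.

(** * Joint-CQ-numbers *)

Lemma filter_forall_finite T (I : Type) (F : set_system T) (P : I -> set T) :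
  Filter F -> finite_set [set: I] -> (forall i, F (P i)) ->
  F [set t | forall i, P i t].
Proof.
move=> FF /(@finite_seqP {classic I})[s Is] FP.
have : F [set t | forall i : {classic I}, i \in s -> P i t].
  elim: s {Is} => [|j s IH]; first by apply: filterE => t i; rewrite in_nil.
  apply: filterS2 (FP j) IH => t Pjt Pst i.
  by rewrite inE => /predU1P[->|/Pst].
apply: filterS => t Pt i; apply: Pt.
by have : [set: {classic I}] i by []; rewrite Is.
Qed.

Section JointCQ.
Context {R : realType} {X : normedModType R} (dot : {dot X for @idfun R}).
Hypothesis hX : euclidean dot.
Context {I J : Type} (A At : I -> set X) (B Bt : J -> set X) (c : X).
Local Notation theta_ := (joint_CQ_number dot A At B Bt c).
Local Notation thetabar := (limiting_joint_CQ_number dot A At B Bt c).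
Implicit Types (delta : R) (k : \bar R).

Lemma joint_CQ_number_leP delta k :
  (theta_ delta <= k)%E <->
  forall i j, (CQ_number dot c delta (A i) (At i) (B j) (Bt j) <= k)%E.
Proof.
split=> [/ereal_supP h i j|h]; first by apply: h; exists (i, j).
by apply/ereal_supP => _ [[i j] _ <-]; exact: h.
Qed.

Lemma joint_CQ_number_nondecreasing delta delta' : delta <= delta' ->
  (theta_ delta <= theta_ delta')%E.
Proof.
move=> dd'; apply/joint_CQ_number_leP => i j.
apply: le_trans (CQ_number_nondecreasing _ _ _ _ _ _ dd') _.
by have /joint_CQ_number_leP := lexx (theta_ delta'); exact.
Qed.

Lemma joint_CQ_number_ge0 delta : (\bigcup_i A i) c -> (\bigcup_j B j) c ->
  0 <= delta -> (0 <= theta_ delta)%E.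
Proof.
move=> [i _ Ac] [j _ Bc] d0.
have /joint_CQ_number_leP/(_ i j) := lexx (theta_ delta).
apply: le_trans; apply: ereal_sup_ubound; exists c, c, 0, 0; split.
- exact: prox_normal0.
- by rewrite oppr0; exact: prox_normal0.
- by rewrite normr0 ler01.
- by rewrite subrr normr0.
- by rewrite dot0l.
Qed.

Lemma limiting_joint_CQ_numberE :
  thetabar = ereal_inf [set theta_ delta | delta in [set d | 0 < d]].
Proof.
apply: cvg_lim => //.
have -> : [set d : R | 0 < d] = [set` `]0, +oo[].
  by apply/seteqP; split=> d /=; rewrite in_itv /= andbT.
apply: nondecreasing_at_right_cvge => // d d' _ _.
exact: joint_CQ_number_nondecreasing.
Qed.

Lemma limiting_joint_CQ_number_le delta : 0 < delta ->
  (thetabar <= theta_ delta)%E.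
Proof.
move=> d0; rewrite limiting_joint_CQ_numberE.
by apply: ereal_inf_lbound; exists delta.
Qed.

Lemma limiting_joint_CQ_number_ge0 : (\bigcup_i A i) c -> (\bigcup_j B j) c ->
  (0 <= thetabar)%E.
Proof.
move=> Ac Bc; rewrite limiting_joint_CQ_numberE.
by apply/ereal_infP => _ [d /ltW d0 <-]; exact: joint_CQ_number_ge0.
Qed.

Lemma near_joint_CQ_number_lt k : (thetabar < k)%E ->
  \forall delta \near 0^'+, (theta_ delta < k)%E.
Proof.
rewrite limiting_joint_CQ_numberE => /ereal_inf_lt[_ [d d0 <-] dk].
near=> e; apply: le_lt_trans dk; apply: joint_CQ_number_nondecreasing.
by near: e; exact: nbhs_right_le.
Unshelve. all: by end_near. Qed.

(** Finiteness of both collections provides one radius [delta] that works for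
    all pairs; the joint-CQ-number is then at most [1 - delta]. *)
Lemma limiting_joint_CQ_number_lt1 :
  (forall i, closed (A i)) -> (forall j, closed (B j)) ->
  finite_set [set: I] -> finite_set [set: J] ->
  (exact_joint_CQ_number dot A At B Bt c < 1)%E -> (thetabar < 1)%E.
Proof.
move=> Acl Bcl Ifin Jfin alpha1.
have : \forall delta \near 0^'+, forall i j,
    (CQ_number dot c delta (A i) (At i) (B j) (Bt j) <= (1 - delta)%R%:E)%E.
  apply: filter_forall_finite => // i; apply: filter_forall_finite => // j.
  apply: CQ_number_lt => //; apply: le_lt_trans alpha1.
  by apply: ereal_sup_ubound; exists (i, j).
move=> cq; near (0 : R)^'+ => delta.
have d0 : 0 < delta by near: delta; exact: nbhs_right_gt.
apply: le_lt_trans (limiting_joint_CQ_number_le d0) _.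
apply: (@le_lt_trans _ _ (1 - delta)%:E); last by rewrite lte_fin gtrBl.
by apply/joint_CQ_number_leP; near: delta.
Unshelve. all: by end_near. Qed.

(** Regularity is inherited by smaller radii, so it holds eventually as the
    radius decreases to 0; eventual properties are stable under finite
    conjunctions. *)
Lemma near_joint_regular E eps :
  finite_set [set: I] /\ joint_superregular dot E c A \/
    uniformly_joint_superregular dot E c A ->
  0 < eps -> \forall delta \near 0^'+, joint_regular dot E eps delta c A.
Proof.
have mono i delta delta' : delta <= delta' ->
    regular dot E eps delta' c (A i) -> regular dot E eps delta c (A i).
  move=> dd' reg y b u Ay Ab yc bc; apply: reg => //.
    exact: le_trans yc dd'.
  exact: le_trans bc dd'.
move=> [[Ifin sreg]|sreg] eps0.
  apply: filter_forall_finite => // i; have [d d0 dreg] := sreg i _ eps0.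
  near=> e; apply: mono dreg; near: e; exact: nbhs_right_le.
have [d d0 dreg] := sreg _ eps0.
near=> e => i; apply: mono (dreg i); near: e; exact: nbhs_right_le.
Unshelve. all: by end_near. Qed.

End JointCQ.

(** * The contraction *)

Section Contraction.
Context {R : realType} {X : normedModType R} (dot : {dot X for @idfun R}).
Hypothesis hX : euclidean dot.
Implicit Types (C Ct D Dt E : set X) (c a b : X) (eps delta k : R).

(** Split |b - a'|^2 as <b - a', b - a> + <b - a', a - a'>: the CQ-number bounds
    the first term, and regularity of [C] the second. *)
Lemma CQ_contraction C Ct D Dt E c eps delta k a b a' :
  0 <= eps -> 0 <= k -> regular dot E eps delta c C ->
  (CQ_number dot c delta C Ct D Dt <= k%:E)%E ->
  C a -> Ct a -> Dt b -> E b -> proj D a b -> proj C b a' ->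
  `|a - c| <= delta -> `|b - c| <= delta -> `|a' - c| <= delta ->
  `|b - a'| <= (k + 2 * eps) * `|a - b|.
Proof.
move=> eps0 k0 reg cq Ca Cta Dtb Eb ab ba' ac bc a'c.
have [Ca' a'min] := (projP _ _ _).1 ba'.
have h1 := reg a a' _ Ca Ca' ac a'c (prox_normal_proj Eb ba').
have h2 : dot (b - a') (b - a) <= k * (`|b - a'| * `|b - a|).
  apply: (CQ_number_dot cq _ _ a'c bc); first exact: prox_normal_proj.
  by rewrite opprB; exact: prox_normal_proj.
have h3 : `|b - a'| ^+ 2 = dot (b - a') (b - a) + dot (b - a') (a - a').
  by rewrite -dotDr addrA subrK dotxx.
(* [a'] is at least as close to [b] as [a] is. *)
have h4 : `|a - a'| <= 2 * `|a - b|.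
  have := ler_distD b a a'; have := a'min _ Ca; rewrite (distrC b a); lra.
have h5 : eps * `|b - a'| * `|a - a'| <= eps * `|b - a'| * (2 * `|a - b|).
  by rewrite ler_wpM2l ?mulr_ge0.
have [->|u0] := eqVneq (b - a') 0.
  by rewrite normr0 !(mulr_ge0, addr_ge0).
have nu0 : 0 < `|b - a'| by rewrite normr_gt0.
rewrite -(ler_pM2l nu0) -expr2 h3 (le_trans (lerD h2 (le_trans h1 h5))) //.
by rewrite (distrC b a); lra.
Qed.

End Contraction.

Section UnionStep.
Context {R : realType} {X : normedModType R} (dot : {dot X for @idfun R}).
Hypothesis hX : euclidean dot.
Context {I J : Type} (A_ At_ : I -> set X) (B_ Bt_ : J -> set X) (c : X).
Let A := \bigcup_i A_ i.
Let B := \bigcup_j B_ j.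
Hypothesis Acl : forall i, closed (A_ i).
Hypothesis AtP : forall i, proj_set (A_ i) (bdry B `\` A) `<=` At_ i.
Hypothesis BtP : forall j, proj_set (B_ j) (bdry A `\` B) `<=` Bt_ j.
Context (eps k delta : R).
Hypothesis eps0 : 0 <= eps.
Hypothesis k0 : 0 <= k.
Hypothesis Areg : joint_regular dot (\bigcup_j Bt_ j) eps delta c A_.
Hypothesis cqk : (joint_CQ_number dot A_ At_ B_ Bt_ c delta <= k%:E)%E.

(** The vectors at [b1] and [a'] are restricted normals because [At_ i] contains
    [a1], a projection of the point [b0] of [bdry B] outside of [A], and [Bt_ j]
    contains [b1], a projection of the point [a1] of [bdry A] outside of [B].
    That [b0] is a boundary point comes from its being a projection of [a0],
    which is why the step looks that far back.  If one of these points is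
    already in both sets, the iteration is stationary and the estimate trivial.
    Otherwise it is obtained for a projection [a'] of [b1] onto a member
    containing [a1], and [a2] is no farther from [b1] than [a']. *)
Lemma MAP_step a0 b0 a1 b1 a2 :
  A a0 -> proj B a0 b0 -> proj A b0 a1 -> proj B a1 b1 -> proj A b1 a2 ->
  `|a1 - c| <= delta -> `|b1 - c| + `|a1 - b1| <= delta ->
  `|b1 - a2| <= (k + 2 * eps) * `|a1 - b1|.
Proof.
move=> Aa0 ab0 ba1 ab1 ba2 a1c b1c.
have rhs0 : 0 <= (k + 2 * eps) * `|a1 - b1|.
  by rewrite !(mulr_ge0, addr_ge0).
have Aa1 : A a1 by case: ba1.
have [Ab1|nAb1] := pselect (A b1).
  by rewrite (proj_id Ab1 ba2) subrr normr0.
have nBa1 : ~ B a1 by move=> Ba1; apply: nAb1; rewrite (proj_id Ba1 ab1).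
have nAb0 : ~ A b0.
  by move=> Ab0; apply: nBa1; rewrite (proj_id Ab0 ba1); case: ab0.
have nBa0 : ~ B a0 by move=> Ba0; apply: nAb0; rewrite (proj_id Ba0 ab0).
have [i _ Aia1] := Aa1.
have [j _ Bjb1] : B b1 by case: ab1.
have Ati : At_ i a1.
  apply: AtP; exists b0; first by split=> //; exact: proj_bdry nBa0 ab0.
  by apply: proj_sub ba1 => // x; exists i.
have b1j : proj (B_ j) a1 b1 by apply: proj_sub ab1 => // x; exists j.
have Btj : Bt_ j b1.
  apply: BtP; exists a1 => //; split=> //; exact: proj_bdry nAb0 ba1.
have [a' b1a'] : proj (A_ i) b1 !=set0.
  by apply: (proj_exists hX) => //; exists a1.
have [Aa' a'min] := (projP _ _ _).1 b1a'.
have a'b1 : `|b1 - a'| <= `|a1 - b1| by rewrite (distrC a1); exact: a'min.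
apply: (@le_trans _ _ `|b1 - a'|).
  by have [_] := (projP _ _ _).1 ba2; apply; exists i.
have cqij := (joint_CQ_number_leP _ _ _ _ _ _ _ _).1 cqk i j.
apply: (CQ_contraction hX eps0 k0 (@Areg i) cqij) => //; first by exists j.
  by rewrite (le_trans _ b1c) // lerDl.
by have := ler_distD b1 a' c; rewrite (distrC a' b1); lra.
Qed.

End UnionStep.

(** * Linear convergence of the iterates *)

Section Convergence.
Context {R : realType} {X : normedModType R} (dot : {dot X for @idfun R}).
Hypothesis hX : euclidean dot.

Lemma geometric_small (theta delta e : R) : 0 <= theta -> theta < 1 -> 0 < e ->
  exists n, delta * theta ^+ n < e.
Proof.
move=> th0 th1 e0.
have : delta * theta ^+ n @[n --> \oo] --> delta * 0.
  by apply: cvgMr; apply: cvg_expr; rewrite ger0_norm.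
rewrite mulr0 => /cvgrPdist_lt/(_ _ e0)[N _ /(_ _ (leqnn N)) /=].
by rewrite sub0r normrN => /ltr_normlW; exists N.
Qed.

(** The steps are dominated by those of a telescoping series; the limit is any
    cluster point of the bounded sequence [u]. *)
Lemma geometric_limit (u : nat -> X) (mu theta : R) :
  0 <= mu -> 0 <= theta ->
  (forall n, `|u n.+1 - u n| <= mu * (theta ^+ n - theta ^+ n.+1)) ->
  exists l, forall n, `|u n - l| <= mu * theta ^+ n.
Proof.
move=> mu0 th0 step.
have cauchy n m : `|u (n + m)%N - u n| <= mu * (theta ^+ n - theta ^+ (n + m)).
  elim: m => [|m IH]; first by rewrite addn0 !subrr normr0 mulr0.
  rewrite addnS; have := ler_distD (u (n + m)%N) (u (n + m).+1) (u n).
  by have := step (n + m)%N; lra.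
have bounded n m : (n <= m)%N -> `|u m - u n| <= mu * theta ^+ n.
  move=> /subnKC <-; apply: le_trans (cauchy _ _) _.
  by rewrite ler_wpM2l // gerBl exprn_ge0.
have [l _ lP] := bounded_cluster hX (fun n => bounded 0%N n (leq0n n)).
exists l => n; apply/ler_addgt0Pr => e e0.
have [m nm um] := lP e n e0; apply: le_trans (ler_distD (u m) _ _) _.
by rewrite lerD ?(ltW um) // distrC bounded.
Qed.

(** With [rho := (1 - theta) * delta / 12], the point [a 0] is within [2 * rho]
    and [b 0] within [4 * rho] of [c], and each full step from [b n] to [b n.+1]
    has length at most [4 * rho * theta ^+ n].  These lengths sum to
    [4 * rho / (1 - theta) = delta / 3], which keeps every iterate in the ball
    where the contraction is available. *)
Lemma MAP_linear_convergence (A B : set X) (c binit : X) (a b : nat -> X)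
    (theta delta : R) :
  closed A -> closed B -> A c -> B c -> 0 <= theta -> theta < 1 -> 0 <= delta ->
  MAP A B binit a b -> `|binit - c| <= (1 - theta) * delta / 12 ->
  (forall n, `|a n.+1 - c| <= 3 * delta ->
     `|b n.+1 - c| + `|a n.+1 - b n.+1| <= 3 * delta ->
     `|b n.+1 - a n.+2| <= theta * `|a n.+1 - b n.+1|) ->
  exists cbar, [/\ A cbar /\ B cbar, `|cbar - c| <= delta,
    `|a 0%N - cbar| <= delta,
    forall n, `|a n.+1 - cbar| <= delta * (1 + theta) / 2 * theta ^+ n &
    forall n, `|b n - cbar| <= delta / 3 * theta ^+ n].
Proof.
move=> Acl Bcl Ac Bc th0 th1 d0 [a0P aP bP] init contr.
set rho := (1 - theta) * delta / 12 in init.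
have rho0 : 0 <= rho by rewrite divr_ge0 // mulr_ge0 // subr_ge0 ltW.
have rhoE : rho = (1 - theta) * delta / 12 by [].
have thd0 : 0 <= theta * delta by rewrite mulr_ge0.
have a0c : `|a 0%N - c| <= 2 * rho.
  have [_ /(_ _ Ac)] := (projP _ _ _).1 a0P.
  by have := ler_distD binit (a 0%N) c; rewrite (distrC _ binit); lra.
have ab0 : `|a 0%N - b 0%N| <= 2 * rho.
  by have [_ /(_ _ Bc)] := (projP _ _ _).1 (bP 0%N); lra.
have b0c : `|b 0%N - c| <= 4 * rho.
  by have := ler_distD (a 0%N) (b 0%N) c; rewrite (distrC (b 0%N) (a 0%N)); lra.
have Aa n : A (a n) by case: n => [|n]; [case: a0P|case: (aP n)].
have Bb n : B (b n) by case: (bP n).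
have ba n : `|b n - a n.+1| <= `|a n - b n|.
  by rewrite (distrC (a n)); have [_ /(_ _ (Aa n))] := (projP _ _ _).1 (aP n).
have ab n : `|a n.+1 - b n.+1| <= `|b n - a n.+1|.
  rewrite (distrC (b n)).
  by have [_ /(_ _ (Bb n))] := (projP _ _ _).1 (bP n.+1).
have p0 n : 0 <= theta ^+ n by rewrite exprn_ge0.
have p1 n : rho * theta ^+ n <= rho by rewrite ler_piMr // exprn_ile1 // ltW.
have pE n : 12 * (rho * theta ^+ n) = delta * (theta ^+ n - theta ^+ n.+1).
  by rewrite rhoE exprS; field.
(* The bounds of the first [n] steps sum to [delta / 3 * (1 - theta ^+ n)]. *)
have gap n : `|b n - a n.+1| <= 2 * rho * theta ^+ n /\
    `|b n - c| <= 4 * rho + delta / 3 * (1 - theta ^+ n).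
  elim: n => [|n [IH1 IH2]].
    rewrite expr0 mulr1 subrr mulr0 addr0.
    by split=> //; exact: le_trans (ba 0%N) _.
  have abn := ab n; have p1n := p1 n; have pEn := pE n.
  have dp0 : 0 <= delta * theta ^+ n by rewrite mulr_ge0.
  have := ler_distD (b n) (a n.+1) c; rewrite (distrC _ (b n)) => an1c.
  have := ler_distD (a n.+1) (b n.+1) c; rewrite (distrC _ (a n.+1)) => bn1c.
  split; last by lra.
  have hc : `|b n.+1 - a n.+2| <= theta * `|a n.+1 - b n.+1|.
    by apply: contr; lra.
  apply: le_trans hc _; rewrite exprS mulrCA ler_wpM2l //; lra.
have [||cbar cb] := @geometric_limit b (delta / 3) theta _ th0.
- by rewrite divr_ge0.
- move=> n; have [gn _] := gap n; have abn := ab n; have pEn := pE n.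
  have := ler_distD (a n.+1) (b n.+1) (b n).
  by rewrite (distrC (b n.+1) (a n.+1)) (distrC (a n.+1) (b n)); lra.
have ca n : `|a n.+1 - cbar| <= (2 * rho + delta / 3) * theta ^+ n.
  have [gn _] := gap n; have := cb n.
  by have := ler_distD (b n) (a n.+1) cbar; rewrite (distrC _ (b n)); lra.
have cb0 := cb 0%N; rewrite expr0 mulr1 in cb0.
exists cbar; split=> [||| n |//].
- split.
  + apply: closed_approx => // e e0.
    have [n ne] := geometric_small (2 * rho + delta / 3) th0 th1 e0.
    by exists (a n.+1) => //; exact: le_lt_trans (ca n) ne.
  + apply: closed_approx => // e e0.
    have [n ne] := geometric_small (delta / 3) th0 th1 e0.
    by exists (b n) => //; exact: le_lt_trans (cb n) ne.
- by have := ler_distD (b 0%N) cbar c; rewrite (distrC cbar (b 0%N)); lra.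
- by have := ler_distD (b 0%N) (a 0%N) cbar; lra.
- by apply: le_trans (ca n) _; rewrite ler_wpM2r //; lra.
Qed.

End Convergence.

Theorem theorem10p14 (R : realType) (X : normedModType R)
    (dot : {dot X for @idfun R}) (hX : euclidean dot)
    (I J : Type) (hI : [set: I] !=set0) (hJ : [set: J] !=set0)
    (A_ At_ : I -> set X) (B_ Bt_ : J -> set X) (c : X)
    (A0 : forall i, A_ i !=set0) (B0 : forall j, B_ j !=set0)
    (Acl : forall i, closed (A_ i)) (Bcl : forall j, closed (B_ j))
    (At0 : forall i, At_ i !=set0) (Bt0 : forall j, Bt_ j !=set0) :
  let A := \bigcup_i A_ i in
  let B := \bigcup_j B_ j in
  let Bt := \bigcup_j Bt_ j in
  let theta_ := joint_CQ_number dot A_ At_ B_ Bt_ c in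
  let thetabar := limiting_joint_CQ_number dot A_ At_ B_ Bt_ c in
  let alphabar := exact_joint_CQ_number dot A_ At_ B_ Bt_ c in
  closed A -> closed B -> A c -> B c ->
  (forall i, proj_set (A_ i) (bdry B `\` A) `<=` At_ i) ->
  (forall j, proj_set (B_ j) (bdry A `\` B) `<=` Bt_ j) ->
  joint_superregular dot Bt c A_ ->
  (* Added for infinite I only: member by member superregularity provides no
     delta common to the whole collection, and the existence claim below can
     then fail, e.g. on the real line for c = 0, I = R, A_ r = {r, 2r},
     At_ r = {0}, J = unit, B_ tt = {0} and Bt_ tt = R, where thetabar = 0. *)
  finite_set [set: I] \/ uniformly_joint_superregular dot Bt c A_ ->
  (thetabar < 1)%E \/
    [/\ finite_set [set: I], finite_set [set: J] & (alphabar < 1)%E] ->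
  (thetabar < 1)%E /\
  forall theta : R, (thetabar < theta%:E)%E -> theta < 1 ->
  (* thetabar lies in [0, 1], so [fine] loses nothing *)
  let eps := (theta - fine thetabar) / 3 in
  let good (delta : R) :=
    [/\ 0 < delta,
        joint_regular dot Bt eps (3 * delta) c A_,
        (theta_ (3 * delta)%R <= thetabar + eps%:E)%E &
        (thetabar + eps%:E < (1 - 2 * eps)%R%:E)%E] in
  [/\ 0 < eps,
      exists delta, good delta &
      forall delta, good delta ->
      forall (b_init : X) (a b : nat -> X),
      `|b_init - c| <= (1 - theta) * delta / 12 ->
      MAP A B b_init a b ->
      exists cbar : X,
        [/\ A cbar /\ B cbar,
            `|cbar - c| <= delta,
            converges_linearly a cbar theta,
            converges_linearly b cbar theta &
            forall n, (1 <= n)%N ->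
              Num.max `|a n - cbar| `|b n - cbar|
                <= delta * (1 + theta) / 2 * theta ^+ n.-1]].
Proof.
move=> A B Bt theta_ thetabar alphabar Acl' Bcl' Ac Bc AtP BtP sreg ureg CQ.
have tb0 : (0 <= thetabar)%E by exact: limiting_joint_CQ_number_ge0.
have tb1 : (thetabar < 1)%E.
  case: CQ => // -[Ifin Jfin alpha1].
  exact: (limiting_joint_CQ_number_lt1 hX).
split=> // theta tbth th1.
have tbE : thetabar = (fine thetabar)%:E.
  by rewrite fineK // ge0_fin_numE // (lt_trans tb1) // ltry.
set tb := fine thetabar in tbE * => eps good.
have tb0' : 0 <= tb by rewrite -lee_fin -tbE.
have tbth' : tb < theta by rewrite -lte_fin -tbE.
have th0 : 0 < theta by exact: le_lt_trans tb0' tbth'.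
have eps0 : 0 < eps by rewrite divr_gt0 // subr_gt0.
have epsE : tb + eps + 2 * eps = theta by rewrite /eps; field.
split=> //.
- have reg : finite_set [set: I] /\ joint_superregular dot Bt c A_ \/
      uniformly_joint_superregular dot Bt c A_ by case: ureg; [left|right].
  (* [r] is the radius [3 * delta]. *)
  near (0 : R)^'+ => r.
  have r3 : 3 * (r / 3) = r by field.
  exists (r / 3); rewrite /good r3; split.
  + by rewrite divr_gt0 //; near: r; exact: nbhs_right_gt.
  + by near: r; exact: near_joint_regular.
  + apply: ltW; near: r; apply: near_joint_CQ_number_lt.
    by rewrite -/thetabar tbE lte_fin ltrDl.
  + by rewrite tbE lte_fin; lra.
- move=> delta [d0 reg cq _] binit a b init mapab.
  rewrite tbE in cq.
  have k0 : 0 <= tb + eps by rewrite addr_ge0 // ltW.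
  have [a0P aP bP] := mapab.
  have contr n : `|a n.+1 - c| <= 3 * delta ->
      `|b n.+1 - c| + `|a n.+1 - b n.+1| <= 3 * delta ->
      `|b n.+1 - a n.+2| <= theta * `|a n.+1 - b n.+1|.
    have Aan : A (a n) by case: n => [|n]; [case: a0P|case: (aP n)].
    rewrite -epsE; apply: (MAP_step hX Acl AtP BtP (ltW eps0) k0 reg cq Aan).
    + exact: bP.
    + exact: aP.
    + exact: bP.
    + exact: aP.
  have [cbar [ABcbar cbarc a0 aS bn]] :=
    MAP_linear_convergence hX Acl' Bcl' Ac Bc (ltW th0) th1 (ltW d0) mapab init
      contr.
  have thn n : 0 <= theta ^+ n by rewrite exprn_ge0 // ltW.
  have dthn n : 0 <= delta * theta ^+ n by rewrite mulr_ge0 // ltW.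
  have dthn1 n : 0 <= theta * (delta * theta ^+ n) by rewrite mulr_ge0 // ltW.
  have dthn2 n : theta * (delta * theta ^+ n) <= delta * theta ^+ n.
    by rewrite ler_piMl // ltW.
  exists cbar; split=> //.
  + split; first by rewrite (ltW th0) th1.
    exists (delta / theta); first by rewrite divr_ge0 // ltW.
    case=> [|n].
      by rewrite expr0 mulr1 (le_trans a0) // ler_pdivlMr // ler_piMr // ltW.
    apply: le_trans (aS n) _; rewrite exprS mulrA divfK ?gt_eqF //.
    have := dthn2 n; lra.
  + split; first by rewrite (ltW th0) th1.
    exists (delta / 3); first by rewrite divr_ge0 // ltW.
    exact: bn.
  + case=> // n _ /=; rewrite ge_max aS /=.
    apply: le_trans (bn n.+1) _; rewrite exprS.
    have := dthn n; have := dthn1 n; have := dthn2 n; lra.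
Unshelve. all: by end_near. Qed.
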